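(* Let $(C,\phi)$ be an $n$-component semicoherent system with continuous and i.i.d. component lifetimes, with signature $(s_1,\ldots,s_n)$, and let $h(x)$ be the diagonal section of its reliability function and $h'(x)$ the derivative of $h(x)$. Then $$k\binom{n}{k}\,s_k = [x^{k-1}]\,(R^{n-1}h')(x+1),\qquad k=1,\ldots,n,$$ and, as polynomial identities in $x$, $$\sum_{k=1}^n \binom{n}{k}\, s_k\, k\, x^{k-1} = (R^{n-1}h')(x+1),$$ $$\sum_{k=1}^n\binom{n}{k}\,s_k\,x^k = \int_0^x(R^{n-1}h')(t+1)\, dt.$$
   Context: $n\ge 1$, $C=[n]=\{1,\ldots,n\}$ is the set of components, and $\phi\colon\{0,1\}^n\to\{0,1\}$ is the structure function. The system is semicoherent: $\phi$ is nondecreasing in each variable, $\phi(0,\ldots,0)=0$ and $\phi(1,\ldots,1)=1$. Boolean vectors $\mathbf{x}\in\{0,1\}^n$ are identified with subsets $A\subseteq C$ by $x_i=1$ iff $i\in A$, so one writes $\phi(A)$. The components have continuous i.i.d. lifetimes $T_1,\ldots,T_n$; $T_{k:n}$ is the $k$-th smallest lifetime and $T_S$ is the system lifetime, i.e. the time at which the system fails, $T_S=\max_{A:\phi(A)=1}\min_{i\in A}T_i$. The signature is $\mathbf{s}=(s_1,\ldots,s_n)$ with $s_k=\Pr(T_S=T_{k:n})$. The reliability function is the multilinear polynomial function $h(x_1,\ldots,x_n)=\sum_{A\subseteq C}\phi(A)\prod_{i\in A}x_i\prod_{i\in C\setminus A}(1-x_i)$ on $[0,1]^n$; its diagonal section is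 the univariate polynomial $h(x)=h(x,\ldots,x)$, of degree at most $n$, regarded as a real polynomial. For a univariate polynomial $f(x)=a_mx^m+\cdots+a_1x+a_0$ of degree at most $m$, the $m$-reflected polynomial $R^mf$ is $(R^mf)(x)=a_0x^m+a_1x^{m-1}+\cdots+a_{m-1}x+a_m$, i.e. $(R^mf)(x)=x^mf(1/x)$. The notation $(R^{n-1}h')(x+1)$ means $R^{n-1}h'$ evaluated at $x+1$, and $[x^k]f(x)$ denotes the coefficient of $x^k$ in the polynomial $f(x)$. *)

(* Defs.v *)
From HB Require Import structures.
From mathcomp Require Import all_boot all_order all_algebra.
From mathcomp Require Import all_classical all_reals all_analysis.

Set Implicit Arguments.
Unset Strict Implicit.
Unset Printing Implicit Defensive.

Import Order.TTheory GRing.Theory Num.Theory.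
Import numFieldNormedType.Exports.

Local Open Scope classical_set_scope.
Local Open Scope ring_scope.

(* Components are indexed by 'I_n, and a Boolean vector x in {0,1}^n is
   identified with the set A = {i | x_i = 1}, so that a structure function is a
   Boolean function of {set 'I_n}. *)
Definition semicoherent (n : nat) (phi : {set 'I_n} -> bool) : Prop :=
  [/\ forall (i : 'I_n) (A : {set 'I_n}), phi A -> phi (i |: A),
      phi finset.set0 = false
    & phi [set: 'I_n]%SET = true].

(* The ring K is arbitrary so that the same formula gives the numerical function
   on R^n and, evaluated at the indeterminate, its diagonal section as a
   polynomial (see horner_reliability_diag). *)
Definition reliability (K : comNzRingType) (n : nat) (phi : {set 'I_n} -> bool)
    (x : 'I_n -> K) : K :=
  \sum_(A : {set 'I_n})
    (phi A)%:R * (\prod_(i in A) x i) * \prod_(i in ~: A) (1 - x i).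

Definition reliability_diag (R : realType) (n : nat)
    (phi : {set 'I_n} -> bool) : {poly R} :=
  reliability phi (fun=> 'X).

Lemma horner_reliability_diag (R : realType) (n : nat)
    (phi : {set 'I_n} -> bool) (x : R) :
  (reliability_diag R phi).[x] = reliability phi (fun=> x).
Proof.
rewrite /reliability_diag /reliability horner_sum; apply: eq_bigr => A _.
rewrite !hornerM !horner_prod -polyC_natr hornerC.
by under eq_bigr do rewrite hornerX;
   under [X in _ * X]eq_bigr do rewrite !hornerE.
Qed.

(* Meant for f of degree at most m. *)
Definition reflect_poly (K : nzRingType) (m : nat) (f : {poly K}) : {poly K} :=
  \poly_(i < m.+1) f`_(m - i).

Lemma horner_reflect_poly (K : fieldType) (m : nat) (f : {poly K}) (x : K) :
  (size f <= m.+1)%N -> x != 0 -> (reflect_poly m f).[x] = x ^+ m * f.[x^-1].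
Proof.
move=> sf x0; rewrite horner_poly (horner_coef_wide _ sf) mulr_sumr.
rewrite (reindex_inj rev_ord_inj) /=; apply: eq_bigr => i _.
rewrite subSS subKn -1?ltnS// mulrCA; congr (_ * _).
by rewrite exprVn expfB_cond// (negbTE x0) add0n -ltnS.
Qed.

Definition mutually_independent (d : measure_display) (Omega : measurableType d)
    (R : realType) (P : probability Omega R) (n : nat)
    (T : 'I_n -> {RV P >-> R}) : Prop :=
  forall (J : {set 'I_n}) (B : 'I_n -> set R),
    (forall i, measurable (B i)) ->
    P (\bigcap_(i in [set` J]) (T i @^-1` B i)) =
    (\prod_(i in J) P (T i @^-1` B i))%E.

Definition identically_distributed (d : measure_display)
    (Omega : measurableType d) (R : realType) (P : probability Omega R) (n : nat)
    (T : 'I_n -> {RV P >-> R}) : Prop :=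
  forall (i j : 'I_n) (B : set R), measurable B ->
    distribution P (T i) B = distribution P (T j) B.

Definition continuous_iid (d : measure_display) (Omega : measurableType d)
    (R : realType) (P : probability Omega R) (n : nat)
    (T : 'I_n -> {RV P >-> R}) : Prop :=
  [/\ forall i, continuous (cdf (T i)),
      mutually_independent T
    & identically_distributed T].

(* The k-th smallest of the n values t i, for 1 <= k <= n. *)
Definition order_stat (R : realType) (n : nat) (t : 'I_n -> R) (k : nat) : R :=
  nth 0 (sort <=%O [seq t i | i <- enum 'I_n]) k.-1.

(* Extended reals only supply the neutral elements of max and min: for a
   semicoherent phi the family {A | phi A} is nonempty and all its members are
   nonempty, so the value is finite. *)
Definition system_lifetime (R : realType) (n : nat) (phi : {set 'I_n} -> bool)
    (t : 'I_n -> R) : \bar R :=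
  (\big[maxe/-oo]_(A : {set 'I_n} | phi A) \big[mine/+oo]_(i in A) (t i)%:E)%E.

Definition signature (d : measure_display) (Omega : measurableType d)
    (R : realType) (P : probability Omega R) (n : nat)
    (phi : {set 'I_n} -> bool) (T : 'I_n -> {RV P >-> R}) (k : nat) : R :=
  fine (P [set w | system_lifetime phi (fun i => T i w) =
                   (order_stat (fun i => T i w) k)%:E]).

(* The integral from a to b, with the usual sign convention when b < a. *)
Definition oriented_integral (R : realType) (a b : R) (f : R -> R) : R :=
  if a <= b then \int[lebesgue_measure]_(t in `[a, b]) f t
  else - \int[lebesgue_measure]_(t in `[b, a]) f t.

(* Main.v *)
Require Import Defs.
From HB Require Import structures.
From mathcomp Require Import all_boot all_order all_algebra.
From mathcomp Require Import all_classical all_reals all_analysis.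
From mathcomp Require Import measurable_realfun ring zify.

(** Let [a_j] be the number of path sets of size [j].  Both sides of the first
    identity equal [(n-k+1) a_{n-k+1} - k a_{n-k}].

    Polynomial side.  Grouping the sum that defines [h] by path sets, [h] is a
    sum of terms [x^j (1-x)^(n-j)].  The derivative of such a term is a
    combination of [x^i (1-x)^(n-1-i)] for [i = j-1] and [i = j], the
    [(n-1)]-reflection of [x^i (1-x)^(n-1-i)] is [(x-1)^(n-1-i)], and the shift
    by [1] turns this into the monomial [x^(n-1-i)].  Coefficients can then be
    read off ([coef_reflected_deriv_diag]).

    Probability side.  Say that [A] outlives its complement when every component
    of [A] fails later than every component outside [A].  When the lifetimes are
    distinct, there is exactly one such set of each size [j <= n], and the
    system fails at the [k]-th failure iff the outliving set of size [n-k+1] is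
    a path set while that of size [n-k] is not ([lifetime_eq_order_statP]).
    The lifetimes are almost surely distinct ([ae_injective]) because their
    common law has no atom, and exchangeable because they are i.i.d.
    ([exchangeable]), so all [C(n,j)] sets of size [j] are equally likely to be
    the outliving one.  Hence the outliving set of size [j] is a path set with
    probability [a_j / C(n,j)], which gives Boland's formula
    [s_k = a_{n-k+1} / C(n,n-k+1) - a_{n-k} / C(n,n-k)] ([signatureE]).
    Multiplying by [k C(n,k)] and using
    [k C(n,k) = (n-k+1) C(n,k-1)] matches the two sides.

    The second identity collects the coefficients, and the third integrates
    them by the fundamental theorem of calculus. *)

Set Implicit Arguments.
Unset Strict Implicit.
Unset Printing Implicit Defensive.

Import Order.TTheory GRing.Theory Num.Theory.
Import numFieldNormedType.Exports.

Local Open Scope classical_set_scope.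
Local Open Scope ring_scope.

(** * Reflected polynomials and the diagonal section *)

Lemma coef_reflect_poly (K : nzRingType) m (f : {poly K}) i :
  (reflect_poly m f)`_i = if (i <= m)%N then f`_(m - i) else 0.
Proof. by rewrite coef_poly ltnS. Qed.

Lemma reflect_polyD (K : nzRingType) m (f g : {poly K}) :
  reflect_poly m (f + g) = reflect_poly m f + reflect_poly m g.
Proof.
apply/polyP => i; rewrite coefD !coef_reflect_poly coefD.
by case: ifP => // _; rewrite addr0.
Qed.

Lemma reflect_polyMn (K : nzRingType) m (f : {poly K}) c :
  reflect_poly m (f *+ c) = reflect_poly m f *+ c.
Proof.
apply/polyP => i; rewrite coefMn !coef_reflect_poly coefMn.
by case: ifP => // _; rewrite mul0rn.
Qed.

Lemma reflect_polyN (K : nzRingType) m (f : {poly K}) :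
  reflect_poly m (- f) = - reflect_poly m f.
Proof.
apply/polyP => i; rewrite coefN !coef_reflect_poly coefN.
by case: ifP => // _; rewrite oppr0.
Qed.

Lemma reflect_poly_sum (K : nzRingType) m (I : finType) (F : I -> {poly K}) :
  reflect_poly m (\sum_i F i) = \sum_i reflect_poly m (F i).
Proof.
apply: (big_morph (reflect_poly m)) => [f g|]; first exact: reflect_polyD.
by apply/polyP => i; rewrite coef_reflect_poly !coef0 if_same.
Qed.

(** Reflection reverses the coefficients, so a factor [X^i] only moves the
    window of coefficients that is read. *)
Lemma reflect_polyXnM (K : nzRingType) m i (f : {poly K}) :
  (size f <= m.+1)%N -> reflect_poly (i + m) ('X^i * f) = reflect_poly m f.
Proof.
move=> sf; apply/polyP => j; rewrite !coef_reflect_poly coefXnM.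
have [jm|mj] := leqP j m.
  rewrite (leq_trans jm (leq_addl _ _)) ifN; last by lia.
  by congr (f`_ _); lia.
case: ifP => // ?; case: ifP => // ?.
by rewrite nth_default//; lia.
Qed.

Lemma size_exp1BX (K : idomainType) m : size ((1 - 'X) ^+ m : {poly K}) = m.+1.
Proof.
have -> : 1 - 'X = - ('X - 1%:P) :> {poly K} by rewrite opprB.
by rewrite exprNn size_Msign size_exp_XsubC.
Qed.

Lemma reflect_poly_exp1BX (K : idomainType) m :
  reflect_poly m ((1 - 'X) ^+ m) = ('X - 1) ^+ m :> {poly K}.
Proof.
elim: m => [|m IH].
  by apply/polyP => -[|i]; rewrite coef_reflect_poly ?subnn//= coef1.
have sz := size_exp1BX K m.
rewrite exprSr [RHS]exprSr -IH; set f := _ ^+ m in sz *.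
apply/polyP => i; rewrite coef_reflect_poly !mulrBr !mulr1 !coefB !coefMX.
rewrite !coef_reflect_poly.
case: i => [|i] /=.
  by rewrite !subn0 (nth_default 0 (n := m.+1)) ?sz.
rewrite !ltnS subSS.
case: (ltngtP i m) => [im|mi|->].
- by rewrite subn_eq0 leqNgt im /= subnS.
- by rewrite subrr.
- by rewrite subnn eqxx/= subr0.
Qed.

Lemma deriv_exp1BX (K : comNzRingType) l :
  ((1 - 'X) ^+ l)^`() = - ((1 - 'X) ^+ l.-1 *+ l) :> {poly K}.
Proof.
rewrite (deriv_exp (1 - 'X) l) derivB derivX.
by rewrite -(polyC1 K) derivC sub0r mulN1r mulNrn polyC1.
Qed.

(** The derivative is [j X^(j-1) (1-X)^l - l X^j (1-X)^(l-1)], and reflection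
    erases the powers of [X] and turns [1 - X] into [X - 1]. *)
Lemma reflect_deriv_bernstein (K : idomainType) m j l : (j + l)%N = m.+1 ->
  reflect_poly m ('X^j * (1 - 'X) ^+ l)^`() =
  ('X - 1) ^+ l *+ j - ('X - 1) ^+ l.-1 *+ l :> {poly K}.
Proof.
move=> jl; rewrite derivM derivXn deriv_exp1BX reflect_polyD mulrnAl mulrN.
rewrite reflect_polyN mulrnAr !reflect_polyMn; congr (_ - _).
  case: j jl => [|j] jl; first by rewrite !mulr0n.
  have -> : m = (j + l)%N by lia.
  by rewrite reflect_polyXnM ?size_exp1BX// reflect_poly_exp1BX.
case: l jl => [|l] jl; first by rewrite !mulr0n.
have -> : m = (j + l)%N by lia.
by rewrite reflect_polyXnM ?size_exp1BX// reflect_poly_exp1BX.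
Qed.

Section DiagonalSection.
Context {R : realType} {n : nat} (phi : {set 'I_n} -> bool).

Lemma reliability_diagE :
  reliability_diag R phi =
  \sum_(A : {set 'I_n}) ('X^#|A| * (1 - 'X) ^+ (n - #|A|)) *+ phi A.
Proof.
rewrite /reliability_diag /reliability; apply: eq_bigr => A _.
have AC : #|~: A| = (n - #|A|)%N by rewrite cardsCs finset.setCK card_ord.
by rewrite !prodr_const AC -mulrA mulr_natl.
Qed.

Lemma reflected_deriv_diag : (1 <= n)%N ->
  reflect_poly n.-1 (reliability_diag R phi)^`() \Po ('X + 1) =
  \sum_(A : {set 'I_n})
    ('X^(n - #|A|) *+ #|A| - 'X^((n - #|A|).-1) *+ (n - #|A|)) *+ phi A.
Proof.
move=> n0; rewrite reliability_diagE raddf_sum/= reflect_poly_sum raddf_sum/=.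
apply: eq_bigr => A _; rewrite derivMn reflect_polyMn raddfMn/=.
have An : (#|A| <= n)%N by rewrite -[n in leqRHS]card_ord max_card.
rewrite reflect_deriv_bernstein; last by rewrite subnKC// prednK.
have E k : (('X - 1) ^+ k : {poly R}) \Po ('X + 1) = 'X^k.
  by rewrite rmorphXn rmorphB rmorph1/= comp_polyX addrK.
by rewrite raddfB/= !raddfMn/= !E.
Qed.

Definition path_set_count (j : nat) : nat :=
  #|[set A : {set 'I_n} | phi A & #|A| == j]%SET|.

Lemma coef_reflected_deriv_diag k : (1 <= k <= n)%N ->
  (reflect_poly n.-1 (reliability_diag R phi)^`() \Po ('X + 1))`_(k.-1) =
  ((n - k).+1)%:R * (path_set_count (n - k).+1)%:R -
  k%:R * (path_set_count (n - k))%:R.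
Proof.
move=> /andP[k0 kn]; rewrite reflected_deriv_diag ?(leq_trans k0)//.
have cnt j : (path_set_count j)%:R =
    \sum_(A : {set 'I_n}) ((#|A| == j) && phi A)%:R :> R.
  rewrite /path_set_count -sum1_card natr_sum big_mkcond; apply: eq_bigr => A _.
  by rewrite inE andbC; case: ifP.
rewrite coef_sum !cnt !mulr_sumr -sumrB; apply: eq_bigr => A _.
have An : (#|A| <= n)%N by rewrite -[n in leqRHS]card_ord max_card.
rewrite coefMn coefB !coefMn !coefXn.
case: (phi A); rewrite ?andbF ?andbT ?mulr0n ?mulr0 ?subr0// mulr1n.
have -> : (k.-1 == n - #|A|)%N = (#|A| == (n - k).+1) by apply/eqP/eqP; lia.
congr (_ - _); last first.
  have [Ank|Ank] := eqVneq #|A| (n - k)%N.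
    by rewrite Ank subKn// eqxx mulr1.
  (* For A of size n the exponent (n - n).-1 is a junk value, killed by the
     factor n - n. *)
  have [->|An'] := eqVneq #|A| n; first by rewrite subnn mulr0n mulr0.
  by rewrite mulr0 (_ : (_ == _) = false) ?mul0rn//; apply/eqP; lia.
by case: eqP => [->|_]; rewrite ?mulr1 ?mulr0 ?mul0rn.
Qed.

End DiagonalSection.

(** * Order statistics and the lifetime of the system *)

Section OrderStat.
Context {R : realType} {n : nat}.
Implicit Types (t u : 'I_n -> R) (phi : {set 'I_n} -> bool).

(** Counting entries below a value characterizes the [k]-th smallest one without
    mentioning the sorted sequence. *)
Lemma order_statP t k x : (1 <= k <= n)%N ->
  order_stat t k = x <->
  (#|[set j | (t j < x)%R]%SET| < k <= #|[set j | (t j <= x)%R]%SET|)%N.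
Proof.
move=> /andP[k0 kn]; set s := sort <=%O [seq t i | i <- enum 'I_n].
have ss : sorted <=%O s := sort_le_sorted _.
have szs : size s = n by rewrite size_sort size_map size_enum_ord.
have cnt (p : pred R) : #|[set j | p (t j)]%SET| = count p s.
  rewrite /s (permP (permEl (perm_sort _ _))) count_map cardE -size_filter.
  by rewrite enumT /enum_mem; congr size; apply: eq_filter => i /=; rewrite inE.
rewrite (cnt (< x)%R) (cnt (<= x)%R) /order_stat -/s; split=> [<-|].
  have kz : (k.-1 < size s)%N by rewrite szs; lia.
  apply/andP; split; [rewrite ltnNge|rewrite leqNgt]; apply/negP => h.
    suff : nth 0 s k.-1 < nth 0 s k.-1 by rewrite ltxx.
    by apply: nth_count_lt; rewrite ?prednK.
  suff : nth 0 s k.-1 < nth 0 s k.-1 by rewrite ltxx.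
  by apply: nth_count_gt; rewrite // kz andbT -ltnS prednK.
case/andP=> lk kl; apply: nth_count_eq => //.
by rewrite prednK// kl andbT -ltnS prednK.
Qed.

(** A path set all of whose components survive until [x] is contained in the set
    of all components that do, so by monotonicity only the latter matters. *)
Lemma system_lifetime_ge phi t x :
  (forall A B : {set 'I_n}, A \subset B -> phi A -> phi B) ->
  (x%:E <= system_lifetime phi t)%E = phi [set i | (x <= t i)%R]%SET.
Proof.
move=> mono; apply/bigmax_geP/idP => [[|[A phiA /bigmin_geP[_ xA]]]|phix].
- by rewrite leNgt ltNyr.
- by apply: mono phiA; apply/fintype.subsetP => i /xA; rewrite inE lee_fin.
- right; exists [set i | (x <= t i)%R]%SET => //.
  by apply/bigmin_geP; split=> [|i]; rewrite ?leey// inE lee_fin.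
Qed.

Lemma system_lifetime_gt phi t x :
  (forall A B : {set 'I_n}, A \subset B -> phi A -> phi B) ->
  (x%:E < system_lifetime phi t)%E = phi [set i | (x < t i)%R]%SET.
Proof.
move=> mono; apply/bigmax_gtP/idP => [[|[A phiA /bigmin_gtP[_ xA]]]|phix].
- by rewrite ltNge leNye.
- by apply: mono phiA; apply/fintype.subsetP => i /xA; rewrite inE lte_fin.
- right; exists [set i | (x < t i)%R]%SET => //.
  by apply/bigmin_gtP; split=> [|i]; rewrite ?ltry// inE lte_fin.
Qed.

End OrderStat.

Section TopSets.
Context {R : realType} {n : nat}.
Implicit Types (t u : 'I_n -> R) (phi : {set 'I_n} -> bool) (A B : {set 'I_n}).

(** Only the ranking of the components matters.  There are finitely many
    rankings, which makes the corresponding events measurable. *)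
Definition order_determined (f : ('I_n -> R) -> Prop) := forall t u,
  (forall i j, (t i <= t j) = (u i <= u j)) -> f t -> f u.

Definition outlives A t := forall i j, i \in A -> j \notin A -> t j < t i.

Lemma order_determined_outlives A : order_determined (outlives A).
Proof. by move=> t u tu At i j iA jA; rewrite ltNge -tu -ltNge; exact: At. Qed.

(** Sets that outlive their complements are nested: [i] in [A] but not in [B]
    and [j] in [B] but not in [A] would each fail after the other. *)
Lemma outlives_sub t A B :
  outlives A t -> outlives B t -> (#|A| <= #|B|)%N -> A \subset B.
Proof.
move=> At Bt AB; apply: contraT => /subsetPn[i iA iB].
have /subsetPn[j jB jA] : ~~ (B \subset A).
  apply: contra iB => BA; suff -> : B = A by [].
  by apply/eqP; rewrite eqEcard BA.
by have := lt_trans (At _ _ iA jA) (Bt _ _ jB iB); rewrite ltxx.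
Qed.

Definition path_outlives phi (j : nat) t :=
  exists A, [/\ phi A, #|A| = j & outlives A t].

Lemma order_determined_path_outlives phi j :
  order_determined (path_outlives phi j).
Proof.
move=> t u tu [A [phiA Aj At]]; exists A; split => //.
exact: order_determined_outlives tu At.
Qed.

Lemma card_survivors_order_stat t k : injective t -> (1 <= k <= n)%N ->
  let x := order_stat t k in
  #|[set j | x <= t j]%SET| = (n - k).+1 /\
  #|[set j | x < t j]%SET| = (n - k)%N.
Proof.
move=> injt kn x; have /order_statP-/(_ kn)/andP[ltk kle] := erefl x.
have cgt : (#|[set j | (x < t j)%R]%SET| = n - #|[set j | (t j <= x)%R]%SET|)%N.
  rewrite -[in X in (X - _)%N](card_ord n).
  rewrite -(cardsC [set j | (t j <= x)%R]%SET) addKn.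
  by apply: eq_card => j; rewrite !inE ltNge.
have cge : (#|[set j | (x <= t j)%R]%SET| = n - #|[set j | (t j < x)%R]%SET|)%N.
  rewrite -[in X in (X - _)%N](card_ord n).
  rewrite -(cardsC [set j | (t j < x)%R]%SET) addKn.
  by apply: eq_card => j; rewrite !inE leNgt.
(* Without ties at most one component fails exactly at x. *)
have : (#|[set j | (t j <= x)%R]%SET| <= #|[set j | (t j < x)%R]%SET|.+1)%N.
  have [i0 /eqP ti0|nox] := pickP [pred i | t i == x]; last first.
    apply/ltnW; rewrite ltnS subset_leq_card//; apply/fintype.subsetP => j.
    by rewrite !inE le_eqVlt; have /= -> := nox j.
  rewrite -add1n -(cards1 i0) (leq_trans _ (leq_card_setU _ _).1)//.
  rewrite subset_leq_card//; apply/fintype.subsetP => j; rewrite !inE le_eqVlt.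
  by rewrite -ti0 (inj_eq injt).
move: ltk kle kn; rewrite cge cgt; lia.
Qed.

Lemma outlives_ge t x : outlives [set j | x <= t j]%SET t.
Proof. by move=> i j; rewrite !inE -ltNge => xi jx; exact: lt_le_trans xi. Qed.

Lemma outlives_gt t x : outlives [set j | x < t j]%SET t.
Proof. by move=> i j; rewrite !inE -leNgt => xi jx; exact: le_lt_trans xi. Qed.

Lemma exists_outlives t j : injective t -> (j <= n)%N ->
  exists2 A : {set 'I_n}, #|A| = j & outlives A t.
Proof.
move=> injt; rewrite leq_eqVlt => /predU1P[->|jn].
  by exists [set: 'I_n]%SET; [rewrite cardsT card_ord|move=> ? ?; rewrite !inE].
have kn : (1 <= n - j <= n)%N by lia.
have [_ c] := card_survivors_order_stat injt kn.
exists [set i | (order_stat t (n - j) < t i)%R]%SET; last exact: outlives_gt.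
by rewrite c subKn// ltnW.
Qed.

Lemma path_outlives_card phi t A : outlives A t ->
  path_outlives phi #|A| t <-> phi A.
Proof.
move=> At; split=> [[B [phiB BA Bt]]|phiA]; last by exists A.
suff -> : A = B by [].
by apply/eqP; rewrite eqEcard (outlives_sub At Bt) ?BA /=.
Qed.

End TopSets.

Section Lifetime.
Context {R : realType} {n : nat} (phi : {set 'I_n} -> bool).
Hypothesis mono : forall A B : {set 'I_n}, A \subset B -> phi A -> phi B.
Implicit Types t : 'I_n -> R.

Lemma system_lifetime_eq t x :
  system_lifetime phi t = x%:E <->
  phi [set j | x <= t j]%SET && ~~ phi [set j | x < t j]%SET.
Proof.
rewrite -(system_lifetime_ge _ _ mono) -(system_lifetime_gt _ _ mono) -leNgt.
by rewrite -eq_le eq_sym; split => /eqP.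
Qed.

(** The [k]-th smallest value is some [t i], and which [i] qualify, as well as
    whether the system fails with component [i], depends only on the sets of
    components that fail before, with or after [i]. *)
Lemma order_determined_lifetime_eq_order_stat k : (1 <= k <= n)%N ->
  order_determined (fun t => system_lifetime phi t = (order_stat t k)%:E).
Proof.
move=> kn t u tu Tx; have [i ti xk] : exists2 i, t i = order_stat t k &
    (#|[set j | (t j < t i)%R]%SET| < k <= #|[set j | (t j <= t i)%R]%SET|)%N.
  have := (order_statP t (order_stat t k) kn).1 erefl; set x := order_stat t k.
  move=> xk; have /subsetPn[i] :
      ~~ ([set j | t j <= x]%SET \subset [set j | t j < x]%SET).
    by apply/negP => /subset_leq_card; move: xk; lia.
  rewrite !inE -leNgt => ix xi; exists i; first by apply/le_anti/andP.
  by have -> : t i = x by apply/le_anti/andP.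
have tul a b : (u a < u b) = (t a < t b) by rewrite !ltNge tu.
move: Tx; rewrite -ti => /system_lifetime_eq Tti.
have lt_tu : [set j | u j < u i]%SET = [set j | t j < t i]%SET.
  by apply/setP => j; rewrite !inE tul.
have le_tu : [set j | u j <= u i]%SET = [set j | t j <= t i]%SET.
  by apply/setP => j; rewrite !inE tu.
have gt_tu : [set j | u i < u j]%SET = [set j | t i < t j]%SET.
  by apply/setP => j; rewrite !inE tul.
have ge_tu : [set j | u i <= u j]%SET = [set j | t i <= t j]%SET.
  by apply/setP => j; rewrite !inE tu.
have -> : order_stat u k = u i.
  by apply/(order_statP u _ kn); rewrite lt_tu le_tu.
by apply/system_lifetime_eq; rewrite gt_tu ge_tu.
Qed.

(** The system fails at [x] iff the components alive just before [x] form a path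
    set but those alive just after [x] do not; for [x] the [k]-th smallest
    lifetime these are the outliving sets of sizes [n-k+1] and [n-k]. *)
Lemma lifetime_eq_order_statP t k : injective t -> (1 <= k <= n)%N ->
  system_lifetime phi t = (order_stat t k)%:E <->
  path_outlives phi (n - k).+1 t /\ ~ path_outlives phi (n - k) t.
Proof.
move=> injt kn; have /= [cge cgt] := card_survivors_order_stat injt kn.
rewrite system_lifetime_eq -{}cge -{}cgt.
rewrite (path_outlives_card phi (@outlives_ge _ _ t _)).
rewrite (path_outlives_card phi (@outlives_gt _ _ t _)).
by split => [/andP[-> /negP]|[-> /negP ->]].
Qed.

Lemma path_outlives_succ t j : injective t -> (j < n)%N ->
  path_outlives phi j t -> path_outlives phi j.+1 t.
Proof.
move=> injt jn [A [phiA Aj At]]; have [B Bj Bt] := exists_outlives injt jn.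
exists B; split => //; apply: mono phiA; apply: outlives_sub At Bt _.
by rewrite Aj Bj.
Qed.

End Lifetime.

(** * Exchangeability and absence of ties *)

Lemma measurable_order_determined (d : measure_display)
    (Omega : measurableType d) (R : realType) (n : nat) (Y : 'I_n -> Omega -> R)
    (f : ('I_n -> R) -> Prop) :
  (forall i, measurable_fun setT (Y i)) -> order_determined f ->
  measurable [set w | f (Y ^~ w)].
Proof.
move=> mY odf.
pose pat (t : 'I_n -> R) : {ffun 'I_n * 'I_n -> bool} :=
  [ffun p => t p.1 <= t p.2].
(* The ranking of the components is one of finitely many patterns. *)
have -> : [set w | f (Y ^~ w)] =
    \bigcup_(r in [set pat t | t in f])
      \bigcap_(p in [set: 'I_n * 'I_n]) [set w | (Y p.1 w <= Y p.2 w) = r p].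
  apply/seteqP; split => [w fw|w [_ [t ft <-] wt]].
    by exists (pat (Y ^~ w)); [exists (Y ^~ w)|move=> p _; rewrite /= ffunE].
  by apply: odf ft => i j; rewrite (wt (i, j) I) ffunE.
apply: fin_bigcup_measurable => [|r _]; first exact: finite_finset.
apply: fin_bigcap_measurable => [|p _]; first exact: finite_finset.
have := measurable_fun_ler (mY p.1) (mY p.2).
by move=> /(_ measurableT [set r p]); rewrite setTI; exact.
Qed.

Section Exchangeability.
Context {d : measure_display} {Omega : measurableType d} {R : realType}
  {P : probability Omega R} {n : nat} (T : 'I_n -> {RV P >-> R}).
Local Open Scope ereal_scope.

Let sample (s : 'I_n -> 'I_n) w : n.-tuple R := [tuple T (s i) w | i < n].

Lemma measurable_sample s : measurable_fun setT (sample s).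
Proof.
apply/measurable_fun_tnthP => i; rewrite (_ : _ \o _ = T (s i))//.
by apply/funext => w; rewrite /= tnth_mktuple.
Qed.

(** Both laws give a box the product of the marginal probabilities of its sides:
    permuting the coordinates only permutes the factors, the components being
    identically distributed.  Boxes form an intersection-stable generating
    family, so the laws agree. *)
Lemma sample_law (s : 'I_n -> 'I_n) (B : set (n.-tuple R)) :
  injective s -> mutually_independent T -> identically_distributed T ->
  measurable B -> P (sample s @^-1` B) = P (sample id @^-1` B).
Proof.
move=> injs indep idist mB.
pose box (C : 'I_n -> set R) := [set x : n.-tuple R | forall i, C i (tnth x i)].
pose G := [set box C | C in [set C | forall i, measurable (C i)]].
have P_box u (C : 'I_n -> set R) : injective u -> (forall i, measurable (C i)) ->
    P (sample u @^-1` box C) = (\prod_(i < n) distribution P (T i) (C i)).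
  move=> inju mC.
  pose v := invF inju.
  have -> : sample u @^-1` box C =
      \bigcap_(j in [set` [set: 'I_n]%SET]) (T j @^-1` C (v j)).
    apply/seteqP; split=> [w Cw j _|w Cw i] /=.
      by have := Cw (v j); rewrite /= tnth_mktuple f_invF.
    by have := Cw (u i); rewrite /= inE /v invF_f tnth_mktuple; exact.
  rewrite indep//= (reindex_inj inju)/=; apply: eq_big => [i|i _].
    by rewrite inE.
  by rewrite /v invF_f; exact: idist.
apply: (@measure_unique _ R _ G (fun=> setT) _ _ _ _
  (pushforward P (sample s)) (pushforward P (sample id))) => //.
- apply/seteqP; split.
    apply: smallest_sub; first exact: smallest_sigma_algebra.
    rewrite -bigcup_seq => A [i _ [C mC <-]]; apply: sub_sigma_algebra.
    exists (fun j => if j == i then C else setT) => [j|]; first by case: ifP.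
    apply/seteqP; split=> [x /(_ i)|x [_ Cx] j]; first by rewrite eqxx.
    by case: eqP => // ->.
  apply: smallest_sub; first exact: sigma_algebra_measurable.
  move=> _ [C mC <-].
  rewrite (_ : box C =
    \bigcap_(i in [set: 'I_n]) ((@tnth _ _)^~ i @^-1` C i)); last first.
    by apply/seteqP; split => x Cx i => [_|]; exact: Cx.
  apply: fin_bigcap_measurable => [|i _]; first exact: finite_finset.
  by rewrite -[X in measurable X]setTI; exact: measurable_tnth.
- move=> _ _ [C mC <-] [C' mC' <-].
  exists (fun i => C i `&` C' i) => [i|]; first exact: measurableI.
  by apply/seteqP; split => [x Cx|x [Cx C'x] i]; [split => i; have [] := Cx i|].
- by exists (fun=> setT) => //; apply/seteqP; split.
- by rewrite bigcup_const.
- exact: measurable_sample.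
- exact: measurable_sample.
- move=> ms mid _ [C mC <-].
  exact: (etrans (P_box s C injs mC) (esym (P_box id C (@inj_id _) mC))).
- by move=> ms _; change (P setT < +oo); rewrite probability_setT ltry.
Qed.

End Exchangeability.

Section NoTies.
Context {d : measure_display} {Omega : measurableType d} {R : realType}
  {P : probability Omega R}.
Local Open Scope ereal_scope.

(** An atom of mass [a] at [x] keeps [F(y) <= F(x) - a] for [y < x]; letting [y]
    tend to [x] from the left gives [a <= 0]. *)
Lemma continuous_cdf_atomless (X : {RV P >-> R}) (x : R) :
  continuous (cdf X) -> distribution P X [set x] = 0.
Proof.
move=> cX; set a := distribution P X [set x].
have afin : a \is a fin_num by rewrite fin_num_measure.
have cdf_le y : (y < x)%R -> cdf X y <= cdf X x - a.
  move=> yx; rewrite leeBrDr//.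
  rewrite /cdf -measureU//; first apply: le_measure; rewrite ?inE//.
  - exact: measurableU.
  - by move=> z [|->]; rewrite /= !in_itv//= => /le_trans; apply; exact: ltW.
  - by apply/seteqP; split=> // z [/= + zx]; rewrite zx in_itv/= leNgt yx.
have cl : cdf X y @[y --> x^'-] --> cdf X x.
  exact: cvg_at_left_filter (cX x).
have : cdf X x <= cdf X x - a.
  rewrite -[leLHS](cvg_lim _ cl)//; apply: lime_le.
    by apply/cvg_ex; exists (cdf X x).
  by near=> y; apply: cdf_le; near: y; exact: nbhs_left_lt.
have cfin : cdf X x \is a fin_num by rewrite fin_num_measure.
rewrite leeBrDr// -[leRHS]adde0 leeD2lE// => a0.
by apply/eqP; rewrite eq_le a0 measure_ge0.
Unshelve. all: by end_near. Qed.

(** By independence the joint law is the product of the two laws, and the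
    diagonal is null for it since its sections are single points, which have
    mass zero under the law of [Y]. *)
Lemma independent_atomless_eq0 (X Y : {RV P >-> R}) :
  (forall A B, measurable A -> measurable B ->
    P (X @^-1` A `&` Y @^-1` B) = P (X @^-1` A) * P (Y @^-1` B)) ->
  (forall y, distribution P Y [set y] = 0) ->
  P [set w | X w = Y w] = 0.
Proof.
move=> indep Y0; pose XY w := (X w, Y w).
pose D := [set z : R * R | z.1 = z.2].
have mD : measurable D.
  have : measurable_fun setT (fun z : R * R => z.1 == z.2).
    exact: measurable_fun_eqr.
  move=> /(_ measurableT [set true]); rewrite setTI => /(_ I).
  by congr measurable; apply/seteqP; split=> z /eqP.
have mXY : measurable_fun setT XY by exact/measurable_fun_pair.
have /(_ mXY) := @product_measure_unique _ _ R _ _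
  (distribution P X) (distribution P Y) (pushforward P XY).
move=> /(_ _ D mD) => PD; transitivity (pushforward P XY D) => //.
rewrite -PD => [|A B mA mB]; last exact: indep.
rewrite /product_measure1 integral0_eq// => x _ /=.
rewrite (_ : xsection D x = [set x]) ?Y0//.
by apply/seteqP; split=> y; rewrite /xsection /= inE /D/= => ->.
Qed.

Lemma ae_eq_probability (A B : set Omega) : measurable A -> measurable B ->
  {ae P, forall w, A w <-> B w} -> P A = P B.
Proof.
move=> mA mB [N [mN N0 subN]].
rewrite -(measureU0 mA mN N0) -(measureU0 mB mN N0); congr (P _).
apply/seteqP; split=> w [Xw|]; try by right.
  have [Nw|Nw] := pselect (N w); [by right|left; apply: contrapT => Bw].
  by apply/Nw/subN => -[/(_ Xw)].
have [Nw|Nw] := pselect (N w); [by right|left; apply: contrapT => Aw].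
by apply/Nw/subN => -[_ /(_ Xw)].
Qed.

End NoTies.

Section Independence.
Context {d : measure_display} {Omega : measurableType d} {R : realType}
  {P : probability Omega R} {n : nat} (T : 'I_n -> {RV P >-> R}).
Local Open Scope ereal_scope.

Lemma mutually_independent_pair i j (A B : set R) : mutually_independent T ->
  i != j -> measurable A -> measurable B ->
  P (T i @^-1` A `&` T j @^-1` B) = P (T i @^-1` A) * P (T j @^-1` B).
Proof.
move=> indep ij mA mB.
have := indep [set i; j]%SET (fun k => if k == i then A else B).
rewrite big_setU1 ?inE//= big_set1 eqxx [j == i]eq_sym (negbTE ij) => <-.
  congr (P _); apply/seteqP; split=> w /=.
    by move=> [Aw Bw] k; rewrite /= !inE; case: eqP => [->//|_ /eqP ->].
  move=> Cw; split.
    by have := Cw i; rewrite /= !inE eqxx; exact.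
  by have := Cw j; rewrite /= !inE eqxx orbT eq_sym (negbTE ij); exact.
by move=> k; case: ifP.
Qed.

Lemma ae_injective : continuous_iid T -> {ae P, forall w, injective (T ^~ w)}.
Proof.
move=> [cT indep _].
have : {ae P, forall w (p : 'I_n * 'I_n), p.1 != p.2 -> T p.1 w != T p.2 w}.
  apply: filter_forall => p; have [_|pp] := eqVneq p.1 p.2; first exact: aeW.
  exists [set w | T p.1 w = T p.2 w]; split.
  - apply: (@measurable_order_determined _ _ _ _ T
      (fun t => t p.1 = t p.2)) => //.
    by move=> t u tu tp; apply/le_anti; rewrite -!tu tp lexx.
  - apply: independent_atomless_eq0; last first.
      by move=> y; exact: continuous_cdf_atomless.
    by move=> A B mA mB; exact: mutually_independent_pair.
  - by move=> w /= /not_implyP[_ /negP/negPn/eqP].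
apply: filterS => w Tw i j Tij; apply/eqP; apply: contraT => ij.
by have := Tw (i, j) ij; rewrite Tij eqxx.
Qed.

Lemma exchangeable (s : 'I_n -> 'I_n) (f : ('I_n -> R) -> Prop) :
  continuous_iid T -> injective s -> order_determined f ->
  P [set w | f (fun i => T (s i) w)] = P [set w | f (T ^~ w)].
Proof.
move=> [_ indep idist] injs odf.
have mB : measurable [set x : n.-tuple R | f (tnth x)].
  apply: (@measurable_order_determined _ _ _ _
    (fun i (x : n.-tuple R) => tnth x i)) => // i.
  exact: measurable_tnth.
have := sample_law injs indep idist mB.
by congr (P _ = P _); apply/seteqP; split=> w /=; congr (f _);
  apply/funext => i; rewrite tnth_mktuple.
Qed.

End Independence.

(** * The signature through path sets *)

(** Listing [A] before its complement renumbers the components so that [A]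
    becomes an initial segment. *)
Lemma exists_injective_prefix n (A : {set 'I_n}) :
  exists2 s : 'I_n -> 'I_n, injective s & forall i, (s i \in A) = (i < #|A|)%N.
Proof.
set r := enum A ++ enum (~: A).
have sr : size r = n.
  by rewrite size_cat -!cardE cardsC card_ord.
have ur : uniq r.
  rewrite cat_uniq !enum_uniq andbT/=; apply/hasPn => i.
  by rewrite !mem_enum inE.
exists (fun i => nth i r i) => [i j|i].
  rewrite (set_nth_default j i) ?sr// => /eqP; rewrite nth_uniq ?sr//.
  by move=> /eqP/val_inj.
rewrite nth_cat -cardE; case: ltnP => iA.
  by rewrite -mem_enum mem_nth// -cardE.
apply/negbTE; have : nth i (enum (~: A)) (i - #|A|) \in enum (~: A).
  by rewrite mem_nth// -cardE ltn_subLR// cardsC card_ord.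
by rewrite mem_enum inE.
Qed.

Lemma semicoherent_mono n (phi : {set 'I_n} -> bool) (A B : {set 'I_n}) :
  semicoherent phi -> A \subset B -> phi A -> phi B.
Proof.
move=> [step _ _] AB phiA.
suff U (r : seq 'I_n) : phi (A :|: [set:: r]).
  by have := U (enum B); rewrite set_enum (finset.setUidPr AB).
elim: r => [|i r IH]; first by rewrite finset.set_nil finset.setU0.
by rewrite finset.set_cons finset.setUCA; exact: step.
Qed.

Section TopSetProbability.
Context {d : measure_display} {Omega : measurableType d} {R : realType}
  {P : probability Omega R} {n : nat} (T : 'I_n -> {RV P >-> R}).
Hypothesis iidT : continuous_iid T.
Local Open Scope ereal_scope.

Let prefix (j : nat) : {set 'I_n} := [set i : 'I_n | (i < j)%N]%SET.

(** By exchangeability, renumbering [A] into an initial segment leaves the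
    probability unchanged, so that only the size of [A] matters. *)
Lemma probability_outlives_card (A : {set 'I_n}) :
  P [set w | outlives A (T ^~ w)] = P [set w | outlives (prefix #|A|) (T ^~ w)].
Proof.
have [s injs sA] := exists_injective_prefix A.
rewrite -(exchangeable iidT injs (order_determined_outlives (A := prefix #|A|))).
congr (P _); apply/seteqP; split=> w /= Aw i j.
  by rewrite !inE -!sA; exact: Aw.
have [v sK vK] := injF_bij injs.
by have := Aw (v i) (v j); rewrite !inE -!sA !vK.
Qed.

Lemma measurable_path_outlives phi j :
  measurable [set w | path_outlives phi j (T ^~ w)].
Proof.
apply: measurable_order_determined => //.
exact: order_determined_path_outlives.
Qed.

Lemma measurable_outlives A : measurable [set w | outlives A (T ^~ w)].
Proof.
apply: measurable_order_determined => //.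
exact: order_determined_outlives.
Qed.

Lemma probability_path_outlives_prefix phi j :
  P [set w | path_outlives phi j (T ^~ w)] =
  ((path_set_count phi j)%:R *
    fine (P [set w | outlives (prefix j) (T ^~ w)]))%:E.
Proof.
pose S := [set A : {set 'I_n} | phi A & #|A| == j]%SET.
have -> : [set w | path_outlives phi j (T ^~ w)] =
    \bigcup_(A in [set` enum S]) [set w | outlives A (T ^~ w)].
  apply/seteqP; split=> w /= [A].
    by case=> phiA /eqP Aj Aw; exists A; rewrite //= mem_enum inE phiA.
  by rewrite /= mem_enum inE => /andP[phiA /eqP Aj] Aw; exists A.
rewrite measure_fin_bigcup//=; last 2 first.
- move=> A B /=; rewrite !mem_enum !inE => /andP[_ /eqP Aj] /andP[_ /eqP Bj].
  move=> [w [Aw Bw]]; apply/eqP; rewrite finset.eqEsubset.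
  by rewrite (outlives_sub Aw Bw) ?(outlives_sub Bw Aw) ?Aj ?Bj.
- by move=> A _; exact: measurable_outlives.
rewrite -fsbig_seq ?enum_uniq// big_enum_cond/=.
transitivity (\sum_(A in S)
    (fine (P [set w | outlives (prefix j) (T ^~ w)]))%:E).
  apply: eq_big => [A|A /andP[]]; rewrite ?andbT// inE => /andP[_ /eqP Aj] _.
  rewrite fineK ?fin_num_measure//; last exact: measurable_outlives.
  by rewrite -Aj; exact: probability_outlives_card.
by rewrite sumEFin sumr_const mulr_natl.
Qed.

(** The common probability of the sets of size [j] is found by letting every set
    be a path set: almost surely some set of size [j] outlives its complement,
    so the [C(n,j)] equal probabilities add up to [1]. *)
Lemma probability_path_outlives phi j : (j <= n)%N ->
  P [set w | path_outlives phi j (T ^~ w)] =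
  ((path_set_count phi j)%:R / 'C(n, j)%:R)%:E.
Proof.
move=> jn; rewrite probability_path_outlives_prefix; congr (_ * _)%:E.
have : P [set w | path_outlives xpredT j (T ^~ w)] = 1.
  rewrite -(probability_setT P); apply: ae_eq_probability => //.
    exact: measurable_path_outlives.
  apply: filterS (ae_injective iidT) => w injw; split=> // _.
  by have [A Aj Aw] := exists_outlives injw jn; exists A.
rewrite probability_path_outlives_prefix => -[].
have -> : path_set_count (n := n) xpredT j = 'C(n, j).
  have := @card_draws 'I_n j; rewrite card_ord => <-; rewrite /path_set_count.
  by apply: eq_card => A; rewrite !inE.
by move=> /(canRL (mulKf _)) ->; rewrite ?mulr1// pnatr_eq0 -lt0n bin_gt0.
Qed.

(** If the outliving set of size [n-k] is a path set then so is the larger one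
    of size [n-k+1]; hence the event that only the latter is one has the
    difference of the two probabilities. *)
Lemma signatureE phi k : semicoherent phi -> (1 <= k <= n)%N ->
  signature phi T k =
  ((path_set_count phi (n - k).+1)%:R / 'C(n, (n - k).+1)%:R -
   (path_set_count phi (n - k))%:R / 'C(n, n - k)%:R)%R.
Proof.
move=> semi kn.
have mono A B := @semicoherent_mono n phi A B semi.
have mk := measurable_path_outlives phi (n - k).
have mk1 := measurable_path_outlives phi (n - k).+1.
have ck : (n - k <= n)%N by lia.
have ck1 : ((n - k).+1 <= n)%N by lia.
pose top j := [set w | path_outlives phi j (T ^~ w)].
have topI : P (top (n - k).+1 `&` top (n - k)%N) = P (top (n - k)%N).
  apply: ae_eq_probability => //; first exact: measurableI.
  apply: filterS (ae_injective iidT) => w injw; split=> [[]//|kw]; split=> //.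
  by apply: path_outlives_succ => //; lia.
have topD : P (top (n - k).+1 `\` top (n - k)%N) =
    P (top (n - k).+1) - P (top (n - k)%N).
  by rewrite -topI; apply: measureD => //; rewrite ltey_eq fin_num_measure.
rewrite !probability_path_outlives// in topD.
transitivity (fine (P (top (n - k).+1 `\` top (n - k)%N))); last by rewrite topD.
congr fine; apply: ae_eq_probability.
- exact: (@measurable_order_determined _ _ _ _ T _ _
    (order_determined_lifetime_eq_order_stat mono kn)).
- exact: measurableD.
- apply: filterS (ae_injective iidT) => w injw.
  exact: lifetime_eq_order_statP.
Qed.

End TopSetProbability.

(** * Integration and conclusion *)

Lemma oriented_integral_deriv (R : realType) (q : {poly R}) (a b : R) :
  oriented_integral a b (horner q^`()) = q.[b] - q.[a].
Proof.
have FTC (u v : R) : u < v ->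
    \int[lebesgue_measure]_(t in `[u, v]) q^`().[t] = q.[v] - q.[u].
  move=> uv; rewrite /Rintegral (@continuous_FTC2 _ _ (horner q))//.
  - by apply: continuous_subspaceT; exact: continuous_horner.
  - split.
    + by move=> x _; exact: derivable_horner.
    + by apply: cvg_at_right_filter; exact: continuous_horner.
    + by apply: cvg_at_left_filter; exact: continuous_horner.
  - by move=> x _; rewrite derivE.
rewrite /oriented_integral; case: (ltgtP a b) => [ab|ba|->].
- exact: FTC.
- by rewrite FTC// opprB.
- by rewrite set_itv1 Rintegral_set1 subrr.
Qed.

Theorem proposition4 (d : measure_display) (Omega : measurableType d)
    (R : realType) (P : probability Omega R) (n : nat)
    (phi : {set 'I_n} -> bool) (T : 'I_n -> {RV P >-> R}) :
  (1 <= n)%N ->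
  semicoherent phi ->
  continuous_iid T ->
  let s := signature phi T in
  let h := reliability_diag R phi in
  let p := reflect_poly n.-1 h^`() \Po ('X + 1) in
  [/\ forall k : nat, (1 <= k <= n)%N ->
        k%:R * 'C(n, k)%:R * s k = p`_(k.-1),
      \sum_(1 <= k < n.+1) ('C(n, k)%:R * s k * k%:R) *: 'X^(k.-1) = p
    & forall x : R,
        \sum_(1 <= k < n.+1) 'C(n, k)%:R * s k * x ^+ k =
        oriented_integral 0 x (fun t => (reflect_poly n.-1 h^`()).[t + 1])].
Proof.
move=> n0 semi iid s h p.
have coefp k : (1 <= k <= n)%N -> k%:R * 'C(n, k)%:R * s k = p`_(k.-1).
  move=> kn; rewrite coef_reflected_deriv_diag// /s signatureE//.
  have C0 j : (j <= n)%N -> 'C(n, j)%:R != 0 :> R.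
    by rewrite pnatr_eq0 -lt0n bin_gt0.
  have [k0 kn'] := andP kn.
  rewrite bin_sub// (_ : 'C(n, (n - k).+1) = 'C(n, k.-1)); last first.
    by rewrite -[RHS]bin_sub; [congr 'C(n, _)|]; lia.
  (* As k C(n,k) = (n - k + 1) C(n,k-1), each term cancels one binomial. *)
  have := mul_bin_left n k.-1; rewrite prednK//.
  rewrite (_ : n - k.-1 = (n - k).+1)%N; last lia.
  move=> /(congr1 (fun m => m%:R : R)); rewrite !natrM => E.
  have Ck := C0 k kn'.
  have Ck1 : 'C(n, k.-1)%:R != 0 :> R by apply: C0; lia.
  by rewrite mulrBr {1}E; congr (_ - _); field.
have size_p : (size p <= n)%N.
  by rewrite size_comp_poly2 ?size_XaddC// -[X in (_ <= X)%N](prednK n0) size_poly.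
have p_sum : \sum_(1 <= k < n.+1) ('C(n, k)%:R * s k * k%:R) *: 'X^(k.-1) = p.
  have -> : p = \poly_(i < n) p`_i.
    apply/polyP => i; rewrite coef_poly; case: ltnP => // ni.
    by rewrite nth_default// (leq_trans size_p).
  rewrite big_add1 /= big_mkord poly_def; apply: eq_bigr => i _.
  by rewrite -(coefp i.+1) ?ltn_ord// mulrC mulrA.
split => // x.
pose q : {poly R} := \sum_(1 <= k < n.+1) ('C(n, k)%:R * s k) *: 'X^k.
have qE y : q.[y] = \sum_(1 <= k < n.+1) 'C(n, k)%:R * s k * y ^+ k.
  by rewrite horner_sum; apply: eq_bigr => k _; rewrite hornerZ hornerXn.
have dq : q^`() = p.
  rewrite -p_sum raddf_sum/=; apply: eq_bigr => k _.
  by rewrite derivZ derivXn -scalerMnr scalerMnl mulr_natr.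
rewrite -qE; transitivity (q.[x] - q.[0]).
  rewrite (qE 0) big_nat big1 ?subr0// => k /andP[k0 _].
  by rewrite expr0n gtn_eqF ?mulr0.
rewrite -oriented_integral_deriv dq; congr oriented_integral; apply/funext => t.
by rewrite horner_comp !hornerE.
Qed.
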